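(* Consider the decomposable quadratic optimization problem $$\min_{\boldsymbol{x}}\ \sum_{i=1}^m\Big(\tfrac12\boldsymbol{x}_i^T\boldsymbol{\Sigma}_i\boldsymbol{x}_i-\boldsymbol{a}_i^T\boldsymbol{x}_i\Big)\quad\text{s.t. } \boldsymbol{A}_{i|i+1}\boldsymbol{x}_i+\boldsymbol{A}_{i+1|i}\boldsymbol{x}_{i+1}=\boldsymbol{c}_{i,i+1},\ \ i=1,\dots,m-1,$$ over the chain graph with nodes $1,\dots,m$ ($m\ge2$) and edges $(i,i+1)$, with node $m$ as root, and let $\boldsymbol{x}^\star$ be its optimal solution. Let $$\boldsymbol{P}_{12}=\boldsymbol{A}_{1|2}\boldsymbol{\Sigma}_1^{-1}\boldsymbol{A}_{1|2}^T,\qquad \boldsymbol{P}_{i,i+1}=\boldsymbol{A}_{i|i+1}\big(\boldsymbol{\Sigma}_i+\boldsymbol{A}_{i|i-1}^T\boldsymbol{P}_{i-1,i}^{-1}\boldsymbol{A}_{i|i-1}\big)^{-1}\boldsymbol{A}_{i|i+1}^T,\quad i=2,\dots,m-1,$$ and assume that all these matrices are symmetric positive definite. Run the following two-stage asynchronous PDMM procedure. Forward computation: set $$\hat{\boldsymbol{m}}_{1\rightarrow 2}=\boldsymbol{c}_{12}-2\boldsymbol{A}_{1|2}\big(\boldsymbol{\Sigma}_1+\boldsymbol{A}_{1|2}^T\boldsymbol{P}_{12}^{-1}\boldsymbol{A}_{1|2}\big)^{-1}\boldsymbol{a}_1,$$ and for $i=2,\dots,m-1$ in this order $$\hat{\boldsymbol{m}}_{i\rightarrow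 i+1}=\boldsymbol{c}_{i,i+1}-2\boldsymbol{A}_{i|i+1}\Big(\boldsymbol{\Sigma}_i+\sum_{u\in\mathcal{N}_i}\boldsymbol{A}_{i|u}^T\boldsymbol{P}_{iu}^{-1}\boldsymbol{A}_{i|u}\Big)^{-1}\big(\boldsymbol{a}_i+\boldsymbol{A}_{i|i-1}^T\boldsymbol{P}_{i,i-1}^{-1}\hat{\boldsymbol{m}}_{i-1\rightarrow i}\big).$$ Backward computation: for $i=m,m-1,\dots,1$ in this order set $$\hat{\boldsymbol{x}}_i=\arg\min_{\boldsymbol{x}_i}\Big[\tfrac12\boldsymbol{x}_i^T\boldsymbol{\Sigma}_i\boldsymbol{x}_i-\boldsymbol{a}_i^T\boldsymbol{x}_i+\sum_{j\in\mathcal{N}_i}\tfrac12\|\boldsymbol{A}_{i|j}\boldsymbol{x}_i-\hat{\boldsymbol{m}}_{j\rightarrow i}\|_{\boldsymbol{P}_{ij}^{-1}}^2\Big]$$ and, if $i>1$, $\hat{\boldsymbol{m}}_{i\rightarrow i-1}=\hat{\boldsymbol{m}}_{i-1\rightarrow i}+\boldsymbol{c}_{i,i-1}-2\boldsymbol{A}_{i|i-1}\hat{\boldsymbol{x}}_i$. Then, for each $i=m,\dots,1$, the estimate $\hat{\boldsymbol{x}}_i$ equals its optimal solution $\boldsymbol{x}_i^\star$ after node $i$ finishes updating its parameters in the backward computation stage.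
   Context: Setting. $\mathcal{N}_i\subseteq\{i-1,i+1\}\cap\{1,\dots,m\}$ is the set of neighbours of node $i$ in the chain (so $\mathcal{N}_1=\{2\}$, $\mathcal{N}_m=\{m-1\}$, and $\mathcal{N}_i=\{i-1,i+1\}$ otherwise). $\boldsymbol{x}_i\in\mathbb{R}^{n_i}$, $\boldsymbol{x}=[\boldsymbol{x}_1^T,\dots,\boldsymbol{x}_m^T]^T$; each $\boldsymbol{\Sigma}_i\in\mathbb{R}^{n_i\times n_i}$ is symmetric positive semi-definite, $\boldsymbol{a}_i\in\mathbb{R}^{n_i}$; for each edge $(i,j)$, $\boldsymbol{A}_{i|j}\in\mathbb{R}^{n_{ij}\times n_i}$, $\boldsymbol{A}_{j|i}\in\mathbb{R}^{n_{ij}\times n_j}$, $\boldsymbol{c}_{ij}=\boldsymbol{c}_{ji}\in\mathbb{R}^{n_{ij}}$. The matrices $\boldsymbol{P}$ carry no direction: $\boldsymbol{P}_{ij}=\boldsymbol{P}_{ji}$. $\|\boldsymbol{y}\|_{\boldsymbol{M}}^2=\boldsymbol{y}^T\boldsymbol{M}\boldsymbol{y}$. Standing assumptions. The Lagrangian $\sum_i(\frac12\boldsymbol{x}_i^T\boldsymbol{\Sigma}_i\boldsymbol{x}_i-\boldsymbol{a}_i^T\boldsymbol{x}_i)+\sum_{i=1}^{m-1}\boldsymbol{\delta}_{i,i+1}^T(\boldsymbol{c}_{i,i+1}-\boldsymbol{A}_{i|i+1}\boldsymbol{x}_i-\boldsymbol{A}_{i+1|i}\boldsymbol{x}_{i+1})$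 has a saddle point $(\boldsymbol{x}^\star,\boldsymbol{\delta}^\star)$; $\boldsymbol{x}^\star$ is then an optimal solution. The inverses in the recursion for $\boldsymbol{P}_{i,i+1}$ are assumed to exist (in particular $\boldsymbol{\Sigma}_1$ is nonsingular). The minimizer in each update is taken to be uniquely defined, i.e. $\boldsymbol{\Sigma}_i+\sum_{u\in\mathcal{N}_i}\boldsymbol{A}_{i|u}^T\boldsymbol{P}_{iu}^{-1}\boldsymbol{A}_{i|u}$ is nonsingular for all $i$. *)

(* Defs.v *)
From HB Require Import structures.
From mathcomp Require Import all_boot all_order all_algebra.

Set Implicit Arguments.
Unset Strict Implicit.
Unset Printing Implicit Defensive.

Import Order.TTheory GRing.Theory Num.Theory.
Local Open Scope ring_scope.

Section Matrices.
Variable R : realFieldType.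

Definition dotv n (u v : 'cV[R]_n) : R := (u^T *m v) 0 0.

Definition qform n (M : 'M[R]_n) (y : 'cV[R]_n) : R := (y^T *m M *m y) 0 0.

Definition psdmx n (M : 'M[R]_n) : Prop :=
  M^T = M /\ forall y, 0 <= qform M y.

Definition pdmx n (M : 'M[R]_n) : Prop :=
  M^T = M /\ forall y, y != 0 -> 0 < qform M y.

Definition is_argmin n (f : 'cV[R]_n -> R) (x : 'cV[R]_n) : Prop :=
  forall y, f x <= f y.

End Matrices.

(* The nodes are 1, ..., m and edge e, for 1 <= e < m, joins e and e+1.  All  *)
(* families are indexed by nat so that i-1 and i+1 need no casts; entries     *)
(* outside these ranges, and A e i with i not an endpoint of e, are never     *)
(* used.  For an edge e = {i, j}, A e i is the matrix written A_{i|j}, so     *)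
(* that A_{i|i+1} = A i i and A_{i+1|i} = A i i.+1.                           *)
Record chain_qp (R : realFieldType) := ChainQP {
  m : nat;
  dimx : nat -> nat;
  dimc : nat -> nat;
  Sigma : forall i, 'M[R]_(dimx i);
  a : forall i, 'cV[R]_(dimx i);
  A : forall e i, 'M[R]_(dimc e, dimx i);
  c : forall e, 'cV[R]_(dimc e)
}.

Section Chain.
Variables (R : realFieldType) (q : chain_qp R).

Definition primal := forall i, 'cV[R]_(dimx q i).
Definition dual := forall e, 'cV[R]_(dimc q e).

Definition node_cost i (y : 'cV[R]_(dimx q i)) : R :=
  2^-1 * qform (Sigma q i) y - dotv (a q i) y.

Definition cost (x : primal) : R := \sum_(1 <= i < (m q).+1) node_cost (x i).

Definition feasible (x : primal) : Prop :=
  forall i, (1 <= i < m q)%N -> A q i i *m x i + A q i i.+1 *m x i.+1 = c q i.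

Definition optimal (x : primal) : Prop :=
  feasible x /\ forall y, feasible y -> cost x <= cost y.

Definition lagrangian (x : primal) (d : dual) : R :=
  cost x + \sum_(1 <= i < m q)
    dotv (d i) (c q i - A q i i *m x i - A q i i.+1 *m x i.+1).

Definition saddle_point (xs : primal) (ds : dual) : Prop :=
  forall (x : primal) (d : dual),
    lagrangian xs d <= lagrangian xs ds /\ lagrangian xs ds <= lagrangian x ds.

Definition neighbours i : seq nat :=
  [seq j <- iota 1 (m q) | (j == i.-1) || (j == i.+1)].

(* For adjacent i and j; symmetric, so P (edge i j) carries no direction. *)
Definition edge (i j : nat) : nat := minn i j.

Definition edge_matrices := forall e, 'M[R]_(dimc q e).

Definition forward_mx (P : edge_matrices) i : 'M[R]_(dimx q i) :=
  Sigma q i + (A q i.-1 i)^T *m invmx (P i.-1) *m A q i.-1 i.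

Definition node_mx (P : edge_matrices) i : 'M[R]_(dimx q i) :=
  Sigma q i + \sum_(u <- neighbours i)
    (A q (edge i u) i)^T *m invmx (P (edge i u)) *m A q (edge i u) i.

Definition P_recursion (P : edge_matrices) : Prop :=
  P 1%N = A q 1 1 *m invmx (Sigma q 1) *m (A q 1 1)^T
  /\ forall i, (1 < i < m q)%N ->
       P i = A q i i *m invmx (forward_mx P i) *m (A q i i)^T.

(* mhat e i is the message sent by node i along edge e = {i, j}, that is,     *)
(* mhat_{i -> j}.                                                             *)
Definition messages := forall e (i : nat), 'cV[R]_(dimc q e).

Definition update_cost (P : edge_matrices) (mhat : messages) i
    (y : 'cV[R]_(dimx q i)) : R :=
  node_cost y + \sum_(j <- neighbours i)
    2^-1 * qform (invmx (P (edge i j)))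
                 (A q (edge i j) i *m y - mhat (edge i j) j).

(* Every message and every estimate is assigned exactly once, so a run is     *)
(* recorded by its final values, subject to the assignments as equations.     *)
Record pdmm_run (P : edge_matrices) (mhat : messages) (xhat : primal) : Prop :=
  PdmmRun {
  forward_first :
    mhat 1%N 1%N =
      c q 1 - 2 *: (A q 1 1 *m
        invmx (Sigma q 1 + (A q 1 1)^T *m invmx (P 1%N) *m A q 1 1) *m a q 1);
  forward_step : forall i, (1 < i < m q)%N ->
    mhat i i =
      c q i - 2 *: (A q i i *m invmx (node_mx P i) *m
        (a q i + (A q i.-1 i)^T *m invmx (P i.-1) *m mhat i.-1 i.-1));
  backward_estimate : forall i, (1 <= i <= m q)%N ->
    is_argmin (@update_cost P mhat i) (xhat i);
  backward_message : forall i, (1 < i <= m q)%N ->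
    mhat i.-1 i = mhat i.-1 i.-1 + c q i.-1 - 2 *: (A q i.-1 i *m xhat i)
}.

End Chain.

(* Main.v *)
Require Import Defs.
From HB Require Import structures.
From mathcomp Require Import all_boot all_order all_algebra.
From mathcomp Require Import zify ring.

Set Implicit Arguments.
Unset Strict Implicit.
Unset Printing Implicit Defensive.

Import Order.TTheory GRing.Theory Num.Theory.
Local Open Scope ring_scope.

(** The optimality conditions of the problem predict every message of the run.
    An optimal point x together with the dual part d of a saddle point satisfies
    feasibility and, at every node i, the stationarity condition
    Sigma_i x_i = a_i + sum over u of A_{i|u}^T d_{iu}
    ([optimal_min_lagrangian], [lagrangian_stationary]).

    Suppose that the message which i receives along each of its edges e is
    A_{i|e} x_i + P_e d_e ([kkt_message]). The penalty term of that edge then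
    has gradient - A_{i|e}^T d_e at x_i, so the gradient of the whole update
    cost at x_i is exactly the stationarity condition; as the Hessian of this
    cost is the nonsingular node matrix, the estimate is x_i
    ([estimate_exact]). So it suffices that all messages have this form.

    In the forward pass write S for the part of the node matrix that excludes
    the outgoing edge, B for the matrix of that edge and
    P = B S^-1 B^T for its weight. With this very choice of P, the factor 2 and
    the extra term B^T P^-1 B in the inverse cancel:
    2 B (S + B^T P^-1 B)^-1 = B S^-1 ([double_mul_invmx]). Substituting the
    stationarity condition, the outgoing message becomes c - B x_i + P d, and
    by feasibility c - B x_i is the term A x of the receiving node
    ([forward_messages_kkt], by induction along the chain). In the backward
    pass, once the estimate of i is exact, its message is
    A x_i + P d + c - 2 A x_i = (c - A x_i) + P d, again of the required form,
    so exactness propagates from the root m down to node 1. *)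

(** * Quadratic forms and first-order conditions *)

Section FirstOrder.
Variable R : realFieldType.

Lemma dotvC n (u v : 'cV[R]_n) : dotv u v = dotv v u.
Proof. by rewrite /dotv -[u in RHS]trmxK -trmx_mul [RHS]mxE. Qed.

Lemma dotvDr n (u v w : 'cV[R]_n) : dotv u (v + w) = dotv u v + dotv u w.
Proof. by rewrite /dotv mulmxDr mxE. Qed.

Lemma dotvZr n t (u v : 'cV[R]_n) : dotv u (t *: v) = t * dotv u v.
Proof. by rewrite /dotv -scalemxAr mxE. Qed.

Lemma dotvBr n (u v w : 'cV[R]_n) : dotv u (v - w) = dotv u v - dotv u w.
Proof. by rewrite dotvDr -scaleN1r dotvZr mulN1r. Qed.

Lemma dotvDl n (u v w : 'cV[R]_n) : dotv (u + v) w = dotv u w + dotv v w.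
Proof. by rewrite !(dotvC _ w) dotvDr. Qed.

Lemma dotvBl n (u v w : 'cV[R]_n) : dotv (u - v) w = dotv u w - dotv v w.
Proof. by rewrite !(dotvC _ w) dotvBr. Qed.

Lemma dotv0l n (u : 'cV[R]_n) : dotv 0 u = 0.
Proof. by rewrite /dotv trmx0 mul0mx mxE. Qed.

Lemma dotv_mulmxr k n (B : 'M[R]_(k, n)) u v :
  dotv u (B *m v) = dotv (B^T *m u) v.
Proof. by rewrite /dotv trmx_mul trmxK mulmxA. Qed.

Lemma dotv_suml n (I : Type) (s : seq I) (F : I -> 'cV[R]_n) v :
  dotv (\sum_(i <- s) F i) v = \sum_(i <- s) dotv (F i) v.
Proof.
by apply: (big_morph (fun u => dotv u v)) => [u w|]; rewrite (dotvDl, dotv0l).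
Qed.

Lemma dotvv_ge0 n (u : 'cV[R]_n) : 0 <= dotv u u.
Proof. by rewrite /dotv mxE sumr_ge0 // => i _; rewrite mxE -expr2 sqr_ge0. Qed.

Lemma dotvv_eq0 n (u : 'cV[R]_n) : dotv u u = 0 -> u = 0.
Proof.
rewrite /dotv mxE => /eqP; rewrite psumr_eq0 => [|i _]; last first.
  by rewrite mxE -expr2 sqr_ge0.
move=> /allP u0; apply/colP => i; rewrite [RHS]mxE; apply/eqP.
by have := u0 i (mem_index_enum _); rewrite /= mxE -expr2 sqrf_eq0.
Qed.

Lemma qform_dotv n (M : 'M[R]_n) y : qform M y = dotv y (M *m y).
Proof. by rewrite /qform /dotv mulmxA. Qed.

Lemma qform_line n (M : 'M[R]_n) u v t : M^T = M ->
  qform M (u + t *: v) = qform M u + 2 * t * dotv (M *m u) v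
                         + t ^+ 2 * qform M v.
Proof.
move=> Msym; rewrite !qform_dotv mulmxDr !dotvDl !dotvDr -scalemxAr !dotvZr.
rewrite !(dotvC (t *: v)) !dotvZr (dotv_mulmxr _ u v) Msym (dotvC (M *m v) v).
ring.
Qed.

Lemma pdmx_unit n (M : 'M[R]_n) : pdmx M -> M \in unitmx.
Proof.
move=> [_ Mpos]; rewrite unitmxE unitfE; apply/det0P => -[v v_neq0 vM0].
have /Mpos : v^T != 0 by rewrite trmx_eq0.
by rewrite /qform trmxK vM0 mul0mx mxE ltxx.
Qed.

(** f is a polynomial of degree at most 2 along every line through y, with
    gradient g at y; being closed under sums, this replaces differentiability
    over a field that carries no topology. *)
Definition quadratic_at n (f : 'cV[R]_n -> R) (y g : 'cV[R]_n) : Prop :=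
  forall z, exists k, forall t,
    f (y + t *: z) = f y + t * dotv g z + t ^+ 2 * k.

Lemma quadratic_atD n (f h : 'cV[R]_n -> R) y gf gh :
  quadratic_at f y gf -> quadratic_at h y gh ->
  quadratic_at (fun x => f x + h x) y (gf + gh).
Proof.
move=> qf qh z; have [kf Ef] := qf z; have [kh Eh] := qh z.
by exists (kf + kh) => t; rewrite Ef Eh dotvDl; ring.
Qed.

Lemma quadratic_at_sum n (I : eqType) (s : seq I) (f : I -> 'cV[R]_n -> R) y g :
  (forall i, i \in s -> quadratic_at (f i) y (g i)) ->
  quadratic_at (fun x => \sum_(i <- s) f i x) y (\sum_(i <- s) g i).
Proof.
elim: s => [|i s IHs] qf z.
  by exists 0 => t; rewrite !big_nil dotv0l; ring.
have [j s_j|k Ek] := quadratic_atD (qf i (mem_head i s)) (IHs _) z.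
  by apply: qf; rewrite inE s_j orbT.
by exists k => t; rewrite !big_cons Ek.
Qed.

Lemma quadratic_at_dotv n (b y : 'cV[R]_n) :
  quadratic_at (fun x => - dotv b x) y (- b).
Proof.
move=> z; exists 0 => t; rewrite dotvDr dotvZr -[- b]sub0r dotvBl dotv0l; ring.
Qed.

Lemma quadratic_at_lsq k n (M : 'M[R]_k) (B : 'M[R]_(k, n)) b y : M^T = M ->
  quadratic_at (fun x => 2^-1 * qform M (B *m x - b)) y
               (B^T *m (M *m (B *m y - b))).
Proof.
move=> Msym z; exists (2^-1 * qform M (B *m z)) => t /=.
rewrite [B *m (y + _)]mulmxDr -scalemxAr addrAC qform_line // -dotv_mulmxr.
by field.
Qed.

Lemma quadratic_at_qform n (M : 'M[R]_n) y : M^T = M ->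
  quadratic_at (fun x => 2^-1 * qform M x) y (M *m y).
Proof.
move=> Msym z; exists (2^-1 * qform M z) => t; rewrite qform_line //; by field.
Qed.

(** Moving from y along - g decreases f to first order, and a short enough step
    keeps the second-order term from compensating. *)
Lemma argmin_gradient_eq0 n (f : 'cV[R]_n -> R) y g :
  quadratic_at f y g -> is_argmin f y -> g = 0.
Proof.
move=> qf ymin; apply: dotvv_eq0; have [k Ek] := qf g.
have [//|g_neq0] := eqVneq (dotv g g) 0.
have g_gt0 : 0 < dotv g g by rewrite lt_def g_neq0 dotvv_ge0.
have d_gt0 : 0 < 1 + `|k| by rewrite ltr_pwDl.
(* The step - s makes the linear term - s^2 (1 + |k|), which outweighs the
   second-order term s^2 k. *)
pose s := dotv g g / (1 + `|k|).
have s_gt0 : 0 < s by rewrite divr_gt0.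
have sE : dotv g g = s * (1 + `|k|) by rewrite /s divfK ?gt_eqF.
have := ymin (y + (- s) *: g); rewrite Ek -subr_ge0.
have -> : f y + - s * dotv g g + (- s) ^+ 2 * k - f y
          = - (s ^+ 2 * (1 + (`|k| - k))) by rewrite sE; ring.
rewrite oppr_ge0 leNgt pmulr_lgt0 ?exprn_gt0 // ltr_pwDl // subr_ge0.
exact: ler_norm.
Qed.

End FirstOrder.

(** * Neighbours and edges of the chain *)

Section ChainGraph.
Variables (R : realFieldType) (q : chain_qp R).

Lemma neighboursE i : (1 <= i <= m q)%N ->
  neighbours q i = (if 1 < i then [:: i.-1] else [::])%N
                   ++ (if i < m q then [:: i.+1] else [::])%N.
Proof.
move=> /andP[i_gt0 le_im]; apply: (@irr_sorted_eq _ ltn ltn_trans ltnn).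
- by apply: sorted_filter (iota_ltn_sorted _ _); apply: ltn_trans.
- case: ifP => _; case: ifP => _ //=; rewrite andbT.
  by apply: leq_ltn_trans (leq_pred _) _.
move=> j; rewrite mem_filter mem_iota mem_cat add1n ltnS.
by case: ifP => ?; case: ifP => ?; rewrite ?in_nil ?inE; lia.
Qed.

Lemma neighboursP i u : (1 <= i <= m q)%N -> u \in neighbours q i ->
  (1 < i)%N /\ u = i.-1 \/ (i < m q)%N /\ u = i.+1.
Proof.
move=> i_node; rewrite neighboursE // mem_cat.
by case/orP; case: ifP => // ?; rewrite inE => /eqP; [left|right].
Qed.

Lemma edge_pred i : edge i i.-1 = i.-1.
Proof. exact/minn_idPr/leq_pred. Qed.

Lemma edge_succ i : edge i i.+1 = i.
Proof. exact/minn_idPl. Qed.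

Lemma sum_neighbours (V : nmodType) (G : nat -> V) i : (1 <= i <= m q)%N ->
  \sum_(u <- neighbours q i) G (edge i u)
  = (if (1 < i)%N then G i.-1 else 0) + (if (i < m q)%N then G i else 0).
Proof.
move=> i_node; rewrite neighboursE // big_cat /=.
by congr (_ + _); case: ifP => _;
   rewrite ?big_nil // big_seq1 (edge_pred, edge_succ).
Qed.

(** Double counting of the pairs (edge, endpoint). *)
Lemma sum_edge_ends (V : nmodType) (G : nat -> nat -> V) :
  \sum_(1 <= e < m q) (G e e + G e e.+1)
  = \sum_(1 <= i < (m q).+1) \sum_(u <- neighbours q i) G (edge i u) i.
Proof.
have [m0|m_gt0] := posnP (m q); first by rewrite m0 !big_geq.
under [RHS]eq_big_nat => i i_node do rewrite (sum_neighbours (G^~ i) i_node).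
rewrite !big_split /= addrC; congr (_ + _).
  by rewrite [RHS]big_ltn //= add0r [RHS]big_add1; apply: eq_big_nat => -[].
rewrite [RHS]big_nat_recr //= ltnn addr0.
by apply: eq_big_nat => i /andP[_ ->].
Qed.

End ChainGraph.

(** * Saddle points and stationarity *)

Section Stationarity.
Variables (R : realFieldType) (q : chain_qp R).
Implicit Types (P : edge_matrices q) (x : primal q) (d : dual q).

(** The Lagrangian is affine in the multiplier, so it can be maximal there only
    if the residuals vanish: shifting the multiplier by the residual r would
    add the squared norm of r. *)
Lemma saddle_point_feasible xs ds : @saddle_point R q xs ds -> feasible xs.
Proof.
move=> saddle.
pose r e := c q e - A q e e *m xs e - A q e e.+1 *m xs e.+1.
have [+ _] := saddle xs (fun e => ds e + r e).
rewrite lerD2l -subr_ge0 -sumrB.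
under eq_bigr => e _ do rewrite dotvDl opprD addrA subrr add0r.
rewrite sumrN oppr_ge0 => le_r0.
have /allP r0 : all (fun e => dotv (r e) (r e) == 0) (index_iota 1 (m q)).
  rewrite -(@psumr_eq0 _ _ _ xpredT) => [|e _]; last exact: dotvv_ge0.
  by rewrite eq_le le_r0 sumr_ge0 // => e _; apply: dotvv_ge0.
move=> i i_edge; have := r0 i; rewrite mem_index_iota i_edge => /(_ isT) /eqP.
by move/dotvv_eq0/eqP; rewrite /r -addrA -opprD subr_eq0 => /eqP <-.
Qed.

Lemma lagrangian_feasible x d : @feasible R q x -> lagrangian x d = cost x.
Proof.
move=> x_feas; rewrite /lagrangian big_nat big1 ?addr0 // => e e_edge.
by rewrite -addrA -opprD x_feas // subrr dotvC dotv0l.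
Qed.

(** The optimal point need not be the primal part of the given saddle point, but
    it can replace it: on feasible points the Lagrangian is the cost, and the
    two points have the same cost. *)
Lemma optimal_min_lagrangian xs ds xstar :
  @saddle_point R q xs ds -> optimal xstar ->
  forall x, lagrangian xstar ds <= lagrangian x ds.
Proof.
move=> saddle [xstar_feas xstar_min] x.
have xs_feas := saddle_point_feasible saddle.
rewrite lagrangian_feasible //; apply: le_trans (xstar_min _ xs_feas) _.
by rewrite -(lagrangian_feasible ds xs_feas); case: (saddle x ds).
Qed.

Definition dual_pull d i : 'cV[R]_(dimx q i) :=
  \sum_(u <- neighbours q i) (A q (edge i u) i)^T *m d (edge i u).

Lemma lagrangian_nodes x d :
  lagrangian x d
  = \sum_(1 <= i < (m q).+1) (node_cost (x i) - dotv (dual_pull d i) (x i))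
    + \sum_(1 <= e < m q) dotv (d e) (c q e).
Proof.
rewrite /lagrangian [in RHS]sumrB -addrA; congr (_ + _).
under [in RHS]eq_bigr => i _ do rewrite dotv_suml.
rewrite -(sum_edge_ends q (fun e i => dotv ((A q e i)^T *m d e) (x i))).
rewrite addrC -sumrB; apply: eq_bigr => e _.
by rewrite !dotvBr !dotv_mulmxr opprD addrA.
Qed.

(** A minimizer of a separable sum minimizes each summand, since one coordinate
    can be changed with the others fixed. *)
Lemma separable_argmin (f : forall i, 'cV[R]_(dimx q i) -> R) x s i :
  uniq s -> i \in s ->
  (forall y : primal q, \sum_(j <- s) f j (x j) <= \sum_(j <- s) f j (y j)) ->
  is_argmin (f i) (x i).
Proof.
move=> s_uniq s_i x_min y; have := x_min (dfwith x y).
rewrite !(bigD1_seq i) //= dfwith_in.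
rewrite [in X in _ <= X](eq_bigr (fun j => f j (x j))) ?lerD2r // => j ne_ji.
by rewrite dfwith_out // eq_sym.
Qed.

Lemma lagrangian_stationary x d i :
  (1 <= i <= m q)%N -> (Sigma q i)^T = Sigma q i ->
  (forall y, lagrangian x d <= lagrangian y d) ->
  Sigma q i *m x i = a q i + dual_pull d i.
Proof.
move=> i_node Sig_sym x_min.
pose f j (y : 'cV_(dimx q j)) := node_cost y - dotv (dual_pull d j) y.
have fi_min : is_argmin (f i) (x i).
  apply: (@separable_argmin f x (index_iota 1 (m q).+1)) => [||y].
  - exact: iota_uniq.
  - by rewrite mem_index_iota ltnS.
  - by have := x_min y; rewrite !lagrangian_nodes lerD2r.
have fi_quad : quadratic_at (f i) (x i)
                 (Sigma q i *m x i + - a q i + - dual_pull d i).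
  apply: quadratic_atD (quadratic_at_dotv _ _).
  exact: quadratic_atD (quadratic_at_qform _ Sig_sym) (quadratic_at_dotv _ _).
have /eqP := argmin_gradient_eq0 fi_quad fi_min.
by rewrite -addrA -opprD subr_eq0 => /eqP.
Qed.

End Stationarity.

(** * Messages at the optimum *)

Section Messages.
Variables (R : realFieldType) (q : chain_qp R).
Implicit Types (x : primal q) (d : dual q).

(** The message received by node i along edge e when the run is at the optimum:
    the minimizer of the update cost of i is then x i. *)
Definition kkt_message (P : edge_matrices q) x d e i : 'cV[R]_(dimc q e) :=
  A q e i *m x i + P e *m d e.

(** After right multiplication by S + B^T M^-1 B the claim reads
    2 B = B + B S^-1 B^T M^-1 B, where B S^-1 B^T M^-1 = 1. *)
Lemma double_mul_invmx k n (S : 'M[R]_n) (B : 'M[R]_(k, n)) (M : 'M[R]_k) :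
  M = B *m invmx S *m B^T -> M \in unitmx -> S \in unitmx ->
  S + B^T *m invmx M *m B \in unitmx ->
  2 *: (B *m invmx (S + B^T *m invmx M *m B)) = B *m invmx S.
Proof.
move=> ME Munit Sunit Nunit; apply: (can_inj (mulmxK Nunit)).
rewrite -scalemxAl mulmxKV // mulmxDr mulmxKV // !mulmxA -ME mulmxV // mul1mx.
by rewrite scaler_nat mulr2n.
Qed.

(** Here S x = r + B^T d is the stationarity condition of the sender, d being
    the multiplier of the outgoing edge; B S^-1 r is then B x - M d. *)
Lemma forward_message_value k n (S : 'M[R]_n) (B : 'M[R]_(k, n)) (M : 'M[R]_k)
    (x r : 'cV[R]_n) (d cc : 'cV[R]_k) :
  M = B *m invmx S *m B^T -> M \in unitmx -> S \in unitmx ->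
  S + B^T *m invmx M *m B \in unitmx -> S *m x = r + B^T *m d ->
  cc - 2 *: (B *m invmx (S + B^T *m invmx M *m B) *m r) = cc - B *m x + M *m d.
Proof.
move=> ME Munit Sunit Nunit Sx.
rewrite scalemxAl double_mul_invmx // -addrA; congr (_ + _).
have -> : r = S *m x - B^T *m d by rewrite Sx addrK.
by rewrite mulmxBr !mulmxA mulmxKV // -ME opprB addrC.
Qed.

(** At y the gradient of the update cost is node_mx P i *m (y - x i): the
    multipliers that the messages carry cancel against those of the
    stationarity condition. *)
Lemma estimate_exact (P : edge_matrices q) mhat x d i y :
  (Sigma q i)^T = Sigma q i ->
  (forall u, u \in neighbours q i -> pdmx (P (edge i u))) ->
  node_mx P i \in unitmx ->
  Sigma q i *m x i = a q i + dual_pull d i ->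
  (forall u, u \in neighbours q i ->
     mhat (edge i u) u = kkt_message P x d (edge i u) i) ->
  is_argmin (@update_cost R q P mhat i) y -> y = x i.
Proof.
move=> Sig_sym Ppd Nunit stat msg y_min.
have f_quad : quadratic_at (@update_cost R q P mhat i) y
    (Sigma q i *m y + - a q i + \sum_(u <- neighbours q i)
       (A q (edge i u) i)^T *m (invmx (P (edge i u)) *m
         (A q (edge i u) i *m y - mhat (edge i u) u))).
  apply: quadratic_atD.
    exact: quadratic_atD (quadratic_at_qform _ Sig_sym) (quadratic_at_dotv _ _).
  apply: quadratic_at_sum => u u_nbr; apply: quadratic_at_lsq.
  by rewrite trmx_inv; have [-> _] := Ppd u u_nbr.
have := argmin_gradient_eq0 f_quad y_min.
have -> : \sum_(u <- neighbours q i)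
       (A q (edge i u) i)^T *m (invmx (P (edge i u)) *m
         (A q (edge i u) i *m y - mhat (edge i u) u))
  = (\sum_(u <- neighbours q i)
      (A q (edge i u) i)^T *m invmx (P (edge i u)) *m A q (edge i u) i) *m
        (y - x i) - dual_pull d i.
  rewrite mulmx_suml -sumrB; apply: eq_big_seq => u u_nbr.
  rewrite msg // /kkt_message opprD addrA -mulmxBr.
  rewrite [invmx _ *m (_ - _)]mulmxBr mulKmx ?(pdmx_unit (Ppd u u_nbr)) //.
  by rewrite [_^T *m (_ - _)]mulmxBr !mulmxA.
have -> : Sigma q i *m y = Sigma q i *m (y - x i) + a q i + dual_pull d i.
  by rewrite mulmxBr stat -addrA subrK.
rewrite [_ + _ + _ - _]addrAC addrK addrACA subrr addr0 -mulmxDl => N0.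
by apply/eqP; rewrite -subr_eq0 -[y - x i](mulKmx Nunit) N0 mulmx0.
Qed.

Lemma kkt_message_succ (P : edge_matrices q) x d i :
  @feasible R q x -> (1 <= i < m q)%N ->
  kkt_message P x d i i.+1 = c q i - A q i i *m x i + P i *m d i.
Proof.
by move=> x_feas ?; rewrite -(x_feas i) // [A q i i *m _ + _]addrC addrK.
Qed.

Lemma dual_pullE d i : (1 <= i <= m q)%N -> dual_pull d i
  = (if (1 < i)%N then (A q i.-1 i)^T *m d i.-1 else 0)
    + (if (i < m q)%N then (A q i i)^T *m d i else 0).
Proof. exact: (sum_neighbours (fun e => (A q e i)^T *m d e)). Qed.

Lemma node_mxE (P : edge_matrices q) i : (1 <= i <= m q)%N ->
  node_mx P i = Sigma q i
    + ((if (1 < i)%N then (A q i.-1 i)^T *m invmx (P i.-1) *m A q i.-1 i else 0)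
      + (if (i < m q)%N then (A q i i)^T *m invmx (P i) *m A q i i else 0)).
Proof.
move=> i_node; rewrite /node_mx.
by rewrite (sum_neighbours (fun e => (A q e i)^T *m invmx (P e) *m A q e i)).
Qed.

(** By induction along the chain: an incoming message of this form contributes
    its multiplier term to the right-hand side of the stationarity condition,
    which leaves exactly the hypothesis of [forward_message_value] for the
    outgoing edge. *)
Lemma forward_messages_kkt (P : edge_matrices q) mhat xhat x d :
  P_recursion P -> Sigma q 1 \in unitmx ->
  (forall i, (1 < i < m q)%N -> forward_mx P i \in unitmx) ->
  (forall e, (1 <= e < m q)%N -> P e \in unitmx) ->
  (forall i, (1 <= i <= m q)%N -> node_mx P i \in unitmx) ->
  @pdmm_run R q P mhat xhat -> feasible x ->
  (forall i, (1 <= i <= m q)%N -> Sigma q i *m x i = a q i + dual_pull d i) ->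
  forall i, (1 <= i < m q)%N -> mhat i i = kkt_message P x d i i.+1.
Proof.
move=> hP hSigma1 hforward Punit hnode hrun x_feas stat.
elim=> // i IHi /andP[_ lt_im]; rewrite kkt_message_succ //.
have i1_node : (1 <= i.+1 <= m q)%N by rewrite (ltnW lt_im).
case: (posnP i) => [i0|i_gt0].
  subst i; rewrite (forward_first hrun).
  apply: forward_message_value => //.
  - by case: hP.
  - exact: Punit.
  - by have := hnode 1%N i1_node; rewrite node_mxE // lt_im add0r.
  - by rewrite stat // dual_pullE // lt_im add0r.
have i1_inner : (1 < i.+1 < m q)%N by rewrite ltnS i_gt0.
have i_edge : (1 <= i < m q)%N by rewrite i_gt0 (ltnW lt_im).
rewrite (forward_step hrun i1_inner).
have NE : node_mx P i.+1 = forward_mx P i.+1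
    + (A q i.+1 i.+1)^T *m invmx (P i.+1) *m A q i.+1 i.+1.
  by rewrite node_mxE // ltnS i_gt0 lt_im addrA.
rewrite NE; apply: forward_message_value.
- by case: hP => _; apply.
- exact: Punit.
- exact: hforward.
- by rewrite -NE; apply: hnode.
rewrite /forward_mx /= IHi // mulmxDl stat // dual_pullE // ltnS i_gt0 lt_im.
rewrite /kkt_message mulmxDr -[_ *m invmx _ *m (P i *m _)]mulmxA.
rewrite mulKmx ?Punit // -!mulmxA -!addrA; congr (_ + _).
by rewrite addrA [RHS]addrC.
Qed.

End Messages.

(** * Exactness of the estimates *)

Theorem theorem3 (R : realFieldType) (q : chain_qp R)
  (hm : (2 <= m q)%N)
  (hSigma : forall i, (1 <= i <= m q)%N -> psdmx (Sigma q i))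
  (hsaddle : exists (xs : primal q) (ds : dual q), saddle_point xs ds)
  (xstar : primal q) (hopt : optimal xstar)
  (P : edge_matrices q) (hP : P_recursion P)
  (hSigma1 : Sigma q 1 \in unitmx)
  (hforward : forall i, (1 < i < m q)%N -> forward_mx P i \in unitmx)
  (hPpd : forall e, (1 <= e < m q)%N -> pdmx (P e))
  (hnode : forall i, (1 <= i <= m q)%N -> node_mx P i \in unitmx)
  (mhat : messages q) (xhat : primal q) (hrun : pdmm_run P mhat xhat) :
  forall i, (1 <= i <= m q)%N -> xhat i = xstar i.
Proof.
have [xs [d saddle]] := hsaddle; have [x_feas _] := hopt.
have Sig_sym i : (1 <= i <= m q)%N -> (Sigma q i)^T = Sigma q i by case/hSigma.
have Punit e : (1 <= e < m q)%N -> P e \in unitmx by move/hPpd/pdmx_unit.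
have stat i : (1 <= i <= m q)%N ->
    Sigma q i *m xstar i = a q i + dual_pull d i.
  move=> i_node; apply: lagrangian_stationary (Sig_sym i i_node) _ => //.
  exact: optimal_min_lagrangian saddle hopt.
have forward := forward_messages_kkt hP hSigma1 hforward Punit hnode hrun
                  x_feas stat.
move=> i; have [n] := ubnP (m q - i); elim: n i => // n IHn i lt_n i_node.
apply: (estimate_exact (Sig_sym i i_node) _ (hnode i i_node) (stat i i_node) _
          (backward_estimate hrun i_node)) => u.
all: case/(neighboursP i_node)=> -[lt_i ->].
- by rewrite edge_pred; apply: hPpd; lia.
- by rewrite edge_succ; apply: hPpd; lia.
- rewrite edge_pred forward; last by lia.
  by rewrite prednK //; lia.
(* The message from i.+1: the reflection c - 2 A x turns the A x of the forward
   message into c - A x, which is the term of node i by feasibility. *)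
have i_edge : (1 <= i < m q)%N by rewrite lt_i andbT; case/andP: i_node.
have i1_node : (1 < i.+1 <= m q)%N by [].
rewrite edge_succ (backward_message hrun i1_node) /= forward // IHn; try lia.
rewrite -(x_feas i i_edge) /kkt_message scaler_nat mulr2n.
set u1 := A q i i.+1 *m _; set u2 := A q i i *m _; set w := P i *m _.
by rewrite [u2 + u1]addrC addrACA [LHS]addrC addKr addrC.
Qed.
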